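(* Let $H$ be a real Hadamard matrix of order $N\geq 12$ (an $N\times N$ matrix with entries in $\{-1,1\}$ and $HH^T=NI$). Then $H$ admits an $\left(\frac{N}{2}+1\right)$-parameter affine orbit.
   Context: A complex Hadamard matrix of order $N$ is an $N\times N$ complex matrix $H$ with $|H_{i,j}|=1$ for all $i,j$ and $HH^\ast=NI$. It is dephased if $H_{1,i}=H_{i,1}=1$ for all $i$. A parametric family of complex Hadamard matrices is affine if the phases (arguments) of its entries are each the sum of a constant and a linear function of the parameters. $H$ admits an $m$-parameter affine orbit if there exists an affine family depending on $m$ independent real parameters, containing a dephased form of $H$ and consisting entirely of dephased complex Hadamard matrices. *)

(* Defs.v *)
From HB Require Import structures.
From mathcomp Require Import all_boot all_order all_algebra.
From mathcomp Require Import complex.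
From mathcomp Require Import all_classical all_reals all_analysis.

Set Implicit Arguments.
Unset Strict Implicit.
Unset Printing Implicit Defensive.

Import Order.TTheory GRing.Theory Num.Theory.

Local Open Scope ring_scope.
Local Open Scope complex_scope.
Local Open Scope sesquilinear_scope.

Definition complex_hadamard (R : realType) (N : nat) (H : 'M[R[i]]_N) : Prop :=
  (forall i j, `|H i j| = 1) /\ H *m H^t* = (N%:R)%:M.

Definition real_hadamard (R : realType) (N : nat) (H : 'M[R]_N) : Prop :=
  (forall i j, H i j = 1 \/ H i j = -1) /\ H *m H^T = (N%:R)%:M.

(* 'I_N counts from 0, so the first row and column have index 0. *)
Definition dephased (R : realType) (N : nat) (H : 'M[R[i]]_N) : Prop :=
  forall i j : 'I_N, i = 0%N :> nat \/ j = 0%N :> nat -> H i j = 1.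

(* Dephasing multiplies rows and columns by unimodular scalars; it does not
   permute them. *)
Definition dephased_form (R : realType) (N : nat) (H K : 'M[R[i]]_N) : Prop :=
  dephased K /\
  exists d e : 'rV[R[i]]_N,
    [/\ forall i, `|d 0 i| = 1,
        forall j, `|e 0 j| = 1
      & K = diag_mx d *m H *m diag_mx e].

Definition cis (R : realType) (x : R) : R[i] := cos x +i* sin x.

(* The parameters are independent when the linear part L of the phases is
   injective: the direction matrices L (delta_mx 0 k) are then linearly
   independent, so the space of phase matrices has dimension exactly m. *)
Definition independent_affine_family (R : realType) (m N : nat)
    (F : 'rV[R]_m -> 'M[R[i]]_N) : Prop :=
  exists (Phi : 'M[R]_N) (L : {linear 'rV[R]_m -> 'M[R]_N}),
    injective L /\ forall t i j, F t i j = cis (Phi i j + L t i j).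

Definition admits_affine_orbit (R : realType) (m N : nat)
    (H : 'M[R[i]]_N) : Prop :=
  exists F : 'rV[R]_m -> 'M[R[i]]_N,
    [/\ independent_affine_family F,
        exists t, dephased_form H (F t)
      & forall t, complex_hadamard (F t) /\ dephased (F t)].

(* Main.v *)
(* Fix two columns c, d of H.  They agree in N/2 rows, and N/2 is even, so the
   rows can be matched in pairs {i, s i} that both agree or both disagree on
   c, d.  Rotating each pair of rows by an angle x_i, i.e. applying
   cos x_i + 'i sin x_i * (swap) on the left, is a unitary operation; because
   H is real it amounts to adding x_i H_ij H_(s i)j to the phase of the entry
   H_ij.  The choice of the pairing makes columns c, d still real multiples of
   each other entrywise, so that they can be rotated in the same way from the
   right, by an angle y.  This gives N/2 + 1 parameters.  After dephasing they
   remain independent as soon as two pairs {p, s p}, {q, s q} on which c, d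
   agree have non-proportional products of rows; since N/2 > 4 such a pairing
   exists. *)

Require Import Defs.
From HB Require Import structures.
From mathcomp Require Import all_boot all_order all_algebra.
From mathcomp Require Import perm complex ring lra zify.
From mathcomp Require Import all_classical all_reals all_analysis.

Set Implicit Arguments.
Unset Strict Implicit.
Unset Printing Implicit Defensive.

Import Order.TTheory GRing.Theory Num.Theory.

Local Open Scope ring_scope.
Local Open Scope complex_scope.
Local Open Scope sesquilinear_scope.

(** * Unit complex numbers and their phases *)

Section Cis.
Variable R : realType.
Implicit Types x y : R.

Lemma cis0 : cis 0 = 1 :> R[i].
Proof. by rewrite /cis cos0 sin0. Qed.

Lemma cisD x y : cis (x + y) = cis x * cis y.
Proof.
by apply/eqP; rewrite eq_complex /= cosD sinD addrC [_ + sin x * _]addrC !eqxx.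
Qed.

Lemma conj_cis x : (cis x)^*%R = cis (- x).
Proof. by rewrite /cis cosN sinN. Qed.

Lemma norm_cis x : `|cis x| = 1.
Proof. by rewrite normc_def /= cos2Dsin2 sqrtr1. Qed.

Lemma cis_sign x (w : R) : w = 1 \/ w = -1 -> cis (x * w) = cos x +i* (w * sin x).
Proof.
by case=> ->; rewrite ?mulr1 ?mul1r ?mulrN1 ?mulN1r /cis ?cosN ?sinN.
Qed.

End Cis.

(** * Gram matrices under unitary factors, rephasing and rotations *)

Section Gram.
Variable R : realType.

Lemma mulmxtC_entry n (M : 'M[R[i]]_n) i k :
  (M *m M^t*) i k = \sum_j M i j * (M k j)^*%R.
Proof. by rewrite mxE; apply: eq_bigr => j _; rewrite !mxE. Qed.

Lemma unitarymx_tr n (M : 'M[R[i]]_n) : M \is unitarymx -> M^T \is unitarymx.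
Proof.
move=> /unitarymxP /mulmx1C h; apply/unitarymxP.
rewrite -trmx1 -h trmx_mul; congr (_ *m _).
by apply/matrixP => i j; rewrite !mxE.
Qed.

Lemma mulmxtC_unitary_l n (a : R[i]) (U M : 'M[R[i]]_n) :
  U \is unitarymx -> M *m M^t* = a%:M -> (U *m M) *m (U *m M)^t* = a%:M.
Proof.
move=> /unitarymxP hU hM.
rewrite trmx_mul map_mxM mulmxA -[U *m M *m _]mulmxA hM mul_mx_scalar.
by rewrite -scalemxAl hU scalemx1.
Qed.

Lemma mulmxtC_unitary_r n (a : R[i]) (V M : 'M[R[i]]_n) :
  V \is unitarymx -> M *m M^t* = a%:M -> (M *m V) *m (M *m V)^t* = a%:M.
Proof.
move=> /unitarymxP hV hM.
by rewrite trmx_mul map_mxM mulmxA -[M *m V *m _]mulmxA hV mulmx1.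
Qed.

(** In the product of row i with the conjugate of row k, the column phases [b] cancel and the row
    phases factor out as one unit scalar, which is 1 when i = k. *)
Lemma complex_hadamard_dephase n (th : 'I_n -> 'I_n -> R) (a b : 'I_n -> R) :
  complex_hadamard (\matrix_(i, j) cis (th i j)) ->
  complex_hadamard (\matrix_(i, j) cis (th i j + a i + b j)).
Proof.
case=> _ /matrixP h; split=> [i j|]; first by rewrite mxE norm_cis.
apply/matrixP => i k; have := h i k; rewrite !mulmxtC_entry => hik.
transitivity (cis (a i) * (cis (a k))^*%R *
   \sum_j (\matrix_(i, j) cis (th i j)) i j * ((\matrix_(i, j) cis (th i j)) k j)^*%R).
  rewrite mulr_sumr; apply: eq_bigr => j _; rewrite !mxE !conj_cis -!cisD.
  by congr cis; ring.
rewrite hik !mxE conj_cis -cisD; case: eqP => [->|_]; last by rewrite mulr0.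
by rewrite subrr cis0 mul1r.
Qed.

Section Rotation.
Variables (n : nat) (s : 'I_n -> 'I_n) (x : 'I_n -> R).
Hypotheses (sK : involutive s) (xs : forall i, x (s i) = x i).

(** On a two-cycle {i, s i} this is the exponential of 'i x_i times the swap. Fixed points of [s]
    are allowed and give the diagonal entry [cis (x i)]; the transposition of two columns has
    many. *)
Definition rotation_mx : 'M[R[i]]_n :=
  \matrix_(i, k) ((cos (x i) *+ (k == i)) +i* (sin (x i) *+ (k == s i))).

Lemma sum_rotation i (F : 'I_n -> R[i]) :
  \sum_k rotation_mx i k * F k =
  (cos (x i))%:C * F i + (0 +i* sin (x i)) * F (s i).
Proof.
have E k : rotation_mx i k * F k = (if k == i then (cos (x i))%:C * F k else 0)
    + (if k == s i then (0 +i* sin (x i)) * F k else 0).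
  rewrite mxE; have -> : (cos (x i) *+ (k == i)) +i* (sin (x i) *+ (k == s i)) =
    (cos (x i) *+ (k == i))%:C + (0 +i* (sin (x i) *+ (k == s i))).
    by apply/eqP; rewrite eq_complex /= addr0 add0r !eqxx.
  rewrite mulrDl; congr (_ + _); case: eqP => //= _;
  by rewrite !mulr0n ?(mul0r (F k)).
by rewrite (eq_bigr _ (fun k _ => E k)) big_split -!big_mkcond !big_pred1_eq.
Qed.

(** Since [x] is constant on the orbits of [s], the two cross terms of rows i and s i, namely 'i sin
    x cos x and its conjugate, cancel. *)
Lemma rotation_unitary : rotation_mx \is unitarymx.
Proof.
apply/unitarymxP/matrixP => i k; rewrite mulmxtC_entry sum_rotation !mxE.
rewrite (inj_eq (inv_inj sK)).
case: (eqVneq i k) => [<-{k}|ik].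
  rewrite (eq_sym (s i)).
  apply/eqP; rewrite eq_complex /=; have := cos2Dsin2 (x i).
  case: (i == s i); rewrite ?mulr1n ?mulr0n => h; apply/andP; split; apply/eqP;
    rewrite -?h; ring.
case: (eqVneq i (s k)) => [->|isk].
  by rewrite sK eqxx xs mulr0n; apply/eqP; rewrite eq_complex /=;
     apply/andP; split; apply/eqP; rewrite /=; ring.
have -> : (s i == k) = false by apply/eqP => e; rewrite -e sK eqxx in isk.
by apply/eqP; rewrite eq_complex /=; apply/andP; split; apply/eqP; rewrite /=; ring.
Qed.

End Rotation.
End Gram.

(** * Orthogonality and sign identities for real Hadamard matrices *)

Section RealHadamard.
Variables (R : realType) (n : nat) (H : 'M[R]_n).
Hypothesis hH : real_hadamard H.

Lemma real_hadamard_sqr i j : H i j * H i j = 1.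
Proof. by case: (hH.1 i j) => ->; rewrite ?mulr1 ?mulrNN ?mulr1. Qed.

Lemma real_hadamard_signM i j k l : H i j * H k l = 1 \/ H i j * H k l = -1.
Proof.
by case: (hH.1 i j) => ->; case: (hH.1 k l) => ->;
  rewrite ?mulr1 ?mulN1r ?mul1r ?opprK; auto.
Qed.

Lemma real_hadamard_row i k : \sum_j H i j * H k j = (n%:R *+ (i == k)).
Proof.
have /matrixP/(_ i k) := hH.2; rewrite !mxE => <-.
by apply: eq_bigr => j _; rewrite !mxE.
Qed.

Lemma real_hadamard_trmx : real_hadamard H^T.
Proof.
split=> [i j|]; first by rewrite mxE; apply: hH.1.
case: (posnP n) => [n0|n_gt0]; first by
  apply/matrixP => i; exfalso; have := ltn_ord i; rewrite {2}n0.
have n0 : n%:R != 0 :> R by rewrite pnatr_eq0 -lt0n.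
have: H *m (n%:R^-1 *: H^T) = 1%:M.
  by rewrite -scalemxAr hH.2 scale_scalar_mx mulVf.
move/mulmx1C; rewrite -scalemxAl trmxK => h.
by rewrite -[LHS](scalerKV n0) h scalemx1.
Qed.

(** Substituting the proportionality into the inner product of the two rows gives n a = 0, so row i
    would vanish, while its entries are signs. *)
Lemma real_hadamard_row_free i k (a : R) :
  i != k -> ~ (forall j, H i j = a * H k j).
Proof.
move=> ik h; have n_gt0 : (0 < n)%N by exact: leq_ltn_trans (leq0n i) (ltn_ord i).
have n0 : n%:R != 0 :> R by rewrite pnatr_eq0 -lt0n.
have := real_hadamard_row i k; rewrite (negbTE ik) mulr0n.
under eq_bigr do rewrite h -mulrA real_hadamard_sqr mulr1.
rewrite sumr_const card_ord -mulr_natl => /eqP; rewrite mulf_eq0 (negbTE n0) /=.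
move=> /eqP a0; have := real_hadamard_sqr i (Ordinal n_gt0).
by rewrite h a0 !mul0r => /eqP; rewrite eq_sym oner_eq0.
Qed.

Lemma real_hadamard_complexE :
  map_mx (real_complex R) H *m (map_mx (real_complex R) H)^t* = (n%:R)%:M.
Proof.
have -> : (map_mx (real_complex R) H)^t* = map_mx (real_complex R) H^T.
  by apply/matrixP => i j; rewrite !mxE; apply: conjc_real.
by rewrite -map_mxM hH.2 map_scalar_mx rmorph_nat.
Qed.

(** * Rotating a real Hadamard matrix from both sides *)

Section Rotated.
Variables (s t : 'I_n -> 'I_n) (x y : 'I_n -> R).
Hypotheses (sK : involutive s) (xs : forall i, x (s i) = x i).
Hypotheses (tK : involutive t) (yt : forall j, y (t j) = y j).
Hypothesis quad : forall i j,
  y j = 0 \/ H i j * H (s i) j = H i (t j) * H (s i) (t j).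

(** By [quad], wherever the right rotation acts, the left rotation has given the entries in columns
    j and t j the same phase factor. They still differ by a real sign, so the second rotation is
    again a pure phase shift. *)
Lemma rotated_entry i j :
  (rotation_mx s x *m map_mx (real_complex R) H *m (rotation_mx t y)^T) i j =
  (H i j)%:C * cis (x i * (H i j * H (s i) j) + y j * (H i j * H i (t j))).
Proof.
pose G i j := (H i j)%:C * cis (x i * (H i j * H (s i) j)).
have EG k l : (rotation_mx s x *m map_mx (real_complex R) H) k l = G k l.
  rewrite mxE sum_rotation !mxE /G cis_sign; last exact: real_hadamard_signM.
  have h := real_hadamard_sqr k l.
  by apply/eqP; rewrite eq_complex /=; apply/andP; split; apply/eqP;
    rewrite ?mulrA ?h; ring.
rewrite mxE; under eq_bigr => k _ do rewrite EG mxE mulrC.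
rewrite (sum_rotation t y j (fun k => G i k)).
rewrite cisD mulrA -/(G i j) (cis_sign (y j)); last exact: real_hadamard_signM.
case: (quad i j) => [y0|q].
  rewrite y0 sin0 cos0 mulr0 mul1r.
  have -> : 0 +i* 0 = 0 :> R[i] by [].
  by rewrite mul0r addr0 mulr1.
(* Both entries carry the same phase; only the sign [H i j * H i (t j)] relates them. *)
have -> : G i (t j) = (H i j * H i (t j))%:C * G i j.
  rewrite /G -q [RHS]mulrA; congr (_ * _).
  rewrite -(rmorphM (real_complex R)); congr (_%:C).
  by rewrite mulrAC real_hadamard_sqr mul1r.
rewrite mulrA -mulrDl mulrC; congr (_ * _).
by apply/eqP; rewrite eq_complex /=; apply/andP; split; apply/eqP; rewrite /=; ring.
Qed.

Lemma rotated_complex_hadamard :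
  complex_hadamard (\matrix_(i, j) ((H i j)%:C *
    cis (x i * (H i j * H (s i) j) + y j * (H i j * H i (t j))))).
Proof.
split=> [i j|].
  rewrite mxE normrM norm_cis mulr1.
  by case: (hH.1 i j) => ->; rewrite ?rmorphN rmorph1 ?normrN normr1.
rewrite -[\matrix_(i, j) _](_ : rotation_mx s x *m map_mx (real_complex R) H
  *m (rotation_mx t y)^T = _); last first.
  by apply/matrixP => i j; rewrite rotated_entry mxE.
apply: mulmxtC_unitary_r; first exact/unitarymx_tr/rotation_unitary.
apply: mulmxtC_unitary_l; first exact: rotation_unitary.
exact: real_hadamard_complexE.
Qed.
End Rotated.

End RealHadamard.

(** * Pairing the rows within a class of even size *)

Section Pairing.

Let sw (k : nat) : nat := if odd k then k.-1 else k.+1.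

Let swK : involutive sw.
Proof. by case=> [//|k]; rewrite /sw /=; case E: (odd k) => //=; rewrite E. Qed.

Let half_sw k : (sw k)./2 = k./2.
Proof.
by case: k => [//|k]; rewrite /sw oddS; case: (boolP (odd k)) => /= hk;
  rewrite uphalf_half ?(negbTE hk) ?hk ?addn0.
Qed.

Let sw_neq k : sw k != k.
Proof. by rewrite /sw; case: ifP => hk; apply/eqP; move: hk; lia. Qed.

Let sw_ltn k m : ~~ odd m -> (sw k < m)%N = (k < m)%N.
Proof. by rewrite /sw; case: ifP => hk; move: hk; lia. Qed.

(* Five elements of the class suffice: among the pairings starting with
   {a,b}, {c,d} and {a,b}, {c,e}, one is good. *)
Lemma exists_pairing (T : finType) (m : nat) (f : pred T)
    (bad : T -> T -> T -> T -> Prop) :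
  #|T| = m.*2 -> ~~ odd #|f| -> (4 < #|f|)%N ->
  (forall a b c d e, d != e -> bad a b c d -> ~ bad a b c e) ->
  exists (s : T -> T) (g : T -> 'I_m),
    [/\ involutive s, forall i, s i != i, forall i, g (s i) = g i,
        forall k, exists i, g i = k & forall i, f (s i) = f i] /\
    exists p q, [/\ f p, f q & ~ bad p (s p) q (s q)].
Proof.
move=> cT ef f4 hbad.
have [x0 _] : exists x, x \in f by apply/card_gt0P; apply: leq_trans f4.
(* The list [u] starts with all elements of [f]. Their number is even, so matching positions 2k and
   2k+1 never pairs an element of [f] with one outside it. *)
have [u [Uu u_all fu bu]] : exists u : seq T, [/\ uniq u, u =i T,
    (forall k, (k < m.*2)%N -> f (nth x0 u k) = (k < #|f|)%N)
    & ~ bad (nth x0 u 0) (nth x0 u 1) (nth x0 u 2) (nth x0 u 3)].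
  have key A : perm_eq A (enum f) -> let u := A ++ enum (predC f) in
      [/\ uniq u, u =i T &
       (forall k, (k < m.*2)%N -> f (nth x0 u k) = (k < #|f|)%N)].
    move=> pA u; have mA := perm_mem pA.
    have sA : size A = #|f| by rewrite (perm_size pA) cardE.
    split.
    - rewrite cat_uniq (perm_uniq pA) !enum_uniq andbT /=.
      by apply/hasPn => x; rewrite mA !mem_enum.
    - by move=> x; rewrite mem_cat mA !mem_enum !inE orbN.
    - move=> k km; rewrite nth_cat sA; case: ltnP => kf.
        have : nth x0 A k \in A by rewrite mem_nth ?sA.
        by rewrite mA mem_enum.
      have : nth x0 (enum (predC f)) (k - #|f|) \in enum (predC f).
        by rewrite mem_nth // -cardE ltn_subLR // (cardC f) cT.
      by rewrite mem_enum !inE => /negbTE.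
  move: f4 key; rewrite cardE;
  case: (enum f) (enum_uniq f) => [|a [|b [|c [|d [|e A]]]]] //.
  move=> Uf _ key; have de : d != e.
    by move: Uf => /= /and5P[_ _ _ + _]; rewrite inE negb_or => /andP[].
  have [B|nB] := EM (bad a b c d); last first.
    by exists ([:: a, b, c, d, e & A] ++ enum (predC f)); case: (key _ (perm_refl _)).
  exists ([:: a, b, c, e, d & A] ++ enum (predC f)).
  case: (key [:: a, b, c, e, d & A]) => //; last by split=> //; apply: hbad B.
  by rewrite !perm_cons (permEl (perm_catCA [:: e] [:: d] A)).
have su : size u = m.*2 by rewrite -cT -(card_uniqP Uu); apply: eq_card.
have iu i : (index i u < m.*2)%N by rewrite -su index_mem u_all.
have su_lt i : (sw (index i u) < size u)%N by rewrite su sw_ltn ?odd_double.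
have gP i : ((index i u)./2 < m)%N by rewrite ltn_half_double.
pose s i := nth x0 u (sw (index i u)).
have is_ i : index (s i) u = sw (index i u) by rewrite index_uniq.
exists s, (fun i => Ordinal (gP i)); split; last first.
  have lt_m k : (k < #|f|)%N -> (k < m.*2)%N.
    by move=> h; rewrite -cT (leq_trans h) ?max_card.
  exists (nth x0 u 0), (nth x0 u 2); rewrite /s !index_uniq ?su ?lt_m; try lia.
  by split; rewrite ?fu ?lt_m //; lia.
split.
- by move=> i; rewrite {1}/s is_ swK nth_index ?u_all.
- move=> i; apply/eqP => e; have := is_ i; rewrite e => e'.
  by have := sw_neq (index i u); rewrite -e' eqxx.
- by move=> i; apply/val_inj; rewrite /= is_ half_sw.
- move=> k; exists (nth x0 u k.*2); apply/val_inj.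
  by rewrite /= index_uniq ?doubleK // su ltn_double.
- move=> i; rewrite fu -?su // -{2}(nth_index x0 (u_all i : i \in u)) fu //.
  exact: sw_ltn.
Qed.

End Pairing.

(** * Agreement of columns and independence of the phases *)

Section Columns.
Variables (R : realType) (n : nat) (H : 'M[R]_n).
Hypothesis hH : real_hadamard H.

Lemma real_hadamard_col c d : \sum_i H i c * H i d = n%:R *+ (c == d).
Proof.
rewrite -(real_hadamard_row (real_hadamard_trmx hH)).
by apply: eq_bigr => i _; rewrite !mxE.
Qed.

(** A product of two signs is twice the indicator of agreement minus 1, and these products sum to 0
    over orthogonal columns. *)
Lemma card_col_agree c d :
  c != d -> (#|[pred i | H i c == H i d]|.*2 = n)%N.
Proof.
move=> cd; have := real_hadamard_col c d; rewrite (negbTE cd) mulr0n.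
have E i : H i c * H i d = (H i c == H i d)%:R *+ 2 - 1.
  have h : (1 == -1 :> R) = false by apply/eqP; lra.
  have h' : (-1 == 1 :> R) = false by apply/eqP; lra.
  by case: (hH.1 i c) => ->; case: (hH.1 i d) => ->; rewrite ?eqxx ?h ?h' /=; ring.
under eq_bigr do rewrite E.
rewrite sumrB sumrMnl -natr_sum sumr_const card_ord -big_mkcond /= sum1_card.
by move/eqP; rewrite subr_eq0 -mulrnA muln2 eqr_nat => /eqP.
Qed.

(** For three columns c, d, e, the sum of (c + d)(c + e) is n by orthogonality, while each term is 0
    or 4. *)
Lemma real_hadamard_dvdn4 : (2 < n)%N -> (4 %| n)%N.
Proof.
move=> n2; pose c := Ordinal (ltnW (ltnW n2)); pose d := Ordinal (ltnW n2).
pose e := Ordinal n2.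
have cd : c != d by []. have ce : c != e by []. have de : d != e by [].
have: \sum_i (H i c + H i d) * (H i c + H i e) = n%:R.
  under eq_bigr do rewrite mulrDl !mulrDr.
  rewrite !big_split /= !real_hadamard_col eqxx (eq_sym d) (negbTE cd) (negbTE ce).
  by rewrite (negbTE de) !mulr0n !addr0.
have E i : (H i c + H i d) * (H i c + H i e) =
    ((H i c == H i d) && (H i c == H i e))%:R *+ 4.
  have h : (1 == -1 :> R) = false by apply/eqP; lra.
  have h' : (-1 == 1 :> R) = false by apply/eqP; lra.
  by case: (hH.1 i c) => ->; case: (hH.1 i d) => ->; case: (hH.1 i e) => ->;
     rewrite ?eqxx ?h ?h' /=; ring.
under eq_bigr do rewrite E.
rewrite sumrMnl -natr_sum -mulrnA => /eqP; rewrite eqr_nat => /eqP <-.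
exact: dvdn_mull.
Qed.

(* The common difference b of the phases of two rows is found by summing over
   the columns: distinct rows are orthogonal, hence \sum_j w i j = 0. *)
Lemma phases_independent (c d : 'I_n) (s : 'I_n -> 'I_n) (x : 'I_n -> R) (y : R)
    (p q : 'I_n) (th : 'I_n -> 'I_n -> R) :
  (4 < n)%N -> c != d -> (forall i, s i != i) ->
  (forall i j, th i j = x i * (H i j * H (s i) j) +
     (y *+ ((j == c) || (j == d))) * (H i c * H i d)) ->
  H p c = H p d -> H q c = H q d ->
  ~ (exists a, forall j, H p j * H (s p) j = a * (H q j * H (s q) j)) ->
  (forall i k j l, th i j - th i l = th k j - th k l) ->
  y = 0 /\ forall i, x i = 0.
Proof.
move=> n4 cd s_neq thE pc qc npq sep.
have n0 : n%:R != 0 :> R by rewrite pnatr_eq0; case: (n) n4.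
pose w i j := H i j * H (s i) j; pose phi i := H i c * H i d.
have sumw i : \sum_j w i j = 0.
  by rewrite real_hadamard_row // eq_sym (negbTE (s_neq i)).
have ww i j : w i j * w i j = 1.
  by rewrite /w mulrACA !real_hadamard_sqr // mulr1.
(* Summing over j kills both [w] terms and keeps the [y] term only at columns c and d, hence the
   factor 2. *)
have diff i k : exists b, n%:R * b = 2 * (y * (phi i - phi k)) /\
    forall j, x i * w i j - x k * w k j +
      (y *+ ((j == c) || (j == d))) * (phi i - phi k) = b.
  exists (th i c - th k c).
  have h j : x i * w i j - x k * w k j +
      (y *+ ((j == c) || (j == d))) * (phi i - phi k) = th i c - th k c.
    have := sep i k j c.
    by rewrite !(thE _ j) -/(w i j) -/(w k j) -/(phi i) -/(phi k); lra.
  split=> //.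
  have : \sum_(j < n) (th i c - th k c) = n%:R * (th i c - th k c).
    by rewrite sumr_const card_ord mulr_natl.
  move <-; under eq_bigr => j _ do rewrite -(h j).
  rewrite big_split /= sumrB -!mulr_sumr !sumw !mulr0 subrr add0r -mulr_suml.
  rewrite (bigD1 c) //= eqxx (bigD1 d) 1?eq_sym //= eqxx orbT big1 ?addr0
    ?mulr1n; first by ring.
  by move=> j /andP[/negbTE -> /negbTE ->].
have phi1 i : H i c = H i d -> phi i = 1.
  by rewrite /phi => ->; rewrite real_hadamard_sqr.
(* Rows p and q both have [phi] = 1, so b = 0 and x_p w_p = x_q w_q; a nonzero x_p would make the
   two row products proportional. *)
have xp : x p = 0.
  apply/eqP/negP => /negP xp; apply: npq; exists (x q / x p) => j.
  have [b []] := diff p q; rewrite !phi1 // subrr !mulr0.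
  move/eqP; rewrite mulf_eq0 (negbTE n0) => /eqP -> /(_ j).
  rewrite mulr0 addr0 => /subr0_eq h; apply: (mulfI xp).
  by rewrite h /w; field; exact: xp.
have [e ec ed] : exists2 e, e != c & e != d.
  have : (0 < #|~: [set c; d]|)%N.
    by have := cardsC [set c; d]; rewrite cards2 cd card_ord; lia.
  by case/card_gt0P => e; rewrite !inE negb_or => /andP[]; exists e.
(* Compare row r with row p, where x_p = 0. Column e gives x_r w = b and column c gives x_r w = b -
   u, with w a sign in each case. Squaring yields u^2 = 2bu, and with nb = 2u this becomes b^2 n (n
   - 4) = 0, so b = 0 because n > 4. *)
have key r : y * (phi r - phi p) = 0 /\ x r = 0.
  have [b [hb h]] := diff r p.
  have := h c; have := h e; rewrite xp eqxx (negbTE ec) (negbTE ed) /=.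
  rewrite mulr0n mulr1n !mul0r subr0 addr0 subr0 => he hc.
  set u := y * _ in hb hc *.
  have h1 : x r * x r = b * b by rewrite -he mulrACA ww mulr1.
  have h2 : x r * x r = (b - u) * (b - u) by rewrite -hc addrK mulrACA ww mulr1.
  have b0 : b = 0.
    have n4' : 4 < n%:R :> R by rewrite (ltr_nat R 4 n).
    have E : (b * b) * (n%:R * (n%:R - 4)) = 0.
      have -> : (b * b) * (n%:R * (n%:R - 4)) =
          (n%:R * b) * (n%:R * b) - 4 * b * (n%:R * b) by ring.
      have hu : u * u = 2 * b * u.
        by apply: subr0_eq; rewrite -[RHS](subrr (b * b)) -{1}h1 h2; ring.
      rewrite hb.
      have -> : 2 * u * (2 * u) - 4 * b * (2 * u) = 4 * (u * u - 2 * b * u) by ring.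
      by rewrite hu subrr mulr0.
    apply/eqP; move/eqP: E; rewrite !mulf_eq0 (negbTE n0) orbb orFb.
    by case/orP => // /eqP; lra.
  split; first by have : n%:R * b = 0 by [rewrite b0 mulr0]; lra.
  by move/eqP: h1; rewrite b0 mulr0 mulf_eq0 orbb => /eqP.
split=> [|r]; last by case: (key r).
(* If y were nonzero, [phi] would be 1 on every row, so columns c and d would coincide instead of
   being orthogonal. *)
apply/eqP/negP => /negP y0.
have := real_hadamard_col c d; rewrite (negbTE cd) mulr0n.
have E r : H r c * H r d = 1.
  have [/eqP] := key r; rewrite mulf_eq0 (negbTE y0) subr_eq0 => /eqP.
  by rewrite (phi1 p).
under eq_bigr do rewrite E.
by rewrite sumr_const card_ord => /eqP; rewrite (negbTE n0).
Qed.

End Columns.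

(** Dephasing acts on phase matrices through the linear map [D], so the family stays affine. The
    kernel of [D] consists of the matrices whose rows differ by constants; the last hypothesis says
    that only t = 0 is sent there, so the dephased directions remain independent. *)
Lemma affine_orbit_dephase (R : realType) (m n : nat) (o : 'I_n)
    (Phi : 'M[R]_n) (L : {linear 'rV[R]_m -> 'M[R]_n}) :
  o = 0%N :> nat ->
  (forall t, complex_hadamard (\matrix_(i, j) cis (Phi i j + L t i j))) ->
  (forall t, (forall i k j l, L t i j - L t i l = L t k j - L t k l) -> t = 0) ->
  admits_affine_orbit m (\matrix_(i, j) cis (Phi i j)).
Proof.
move=> o0 hL injL.
pose D (M : 'M[R]_n) := \matrix_(i, j) (M i j - M i o - M o j + M o o).
have D_linear : linear (D \o L).
  by move=> a u v; apply/matrixP => i j; rewrite !mxE linearP !mxE; ring.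
pose DL : {linear 'rV[R]_m -> 'M[R]_n} :=
  HB.pack (D \o L) (GRing.isLinear.Build _ _ _ _ (D \o L) D_linear).
exists (fun t => \matrix_(i, j) cis (D Phi i j + DL t i j)); split.
- exists (D Phi), DL; split; last by move=> t i j; rewrite mxE.
  apply: raddf_inj => t /matrixP h; apply: injL => i k j l.
  by have := h i j; have := h k j; have := h i l; have := h k l;
     rewrite !mxE /=; lra.
- exists 0; split.
    move=> i j ij; rewrite linear0 !mxE addr0.
    have [->|->] : i = o \/ j = o.
    + by case: ij => ij; [left|right]; apply: val_inj; rewrite /= ij o0.
    + by rewrite -[RHS]cis0; congr cis; ring.
    + by rewrite -[RHS]cis0; congr cis; ring.
  (* The corner phase [Phi o o], subtracted twice by the row and column corrections, is restored on
     the row side. *)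
  exists (\row_i cis (- Phi i o + Phi o o)), (\row_j cis (- Phi o j)).
  split=> [i|j|]; rewrite ?mxE ?norm_cis //.
  apply/matrixP => i j; rewrite linear0 mul_mx_diag mul_diag_mx !mxE -!cisD.
  by congr cis; ring.
- move=> t; split; last first.
    move=> i j ij; rewrite !mxE.
    have [->|->] : i = o \/ j = o.
    + by case: ij => ij; [left|right]; apply: val_inj; rewrite /= ij o0.
    + by rewrite -[RHS]cis0; congr cis; rewrite /=; ring.
    + by rewrite -[RHS]cis0; congr cis; rewrite /=; ring.
  have -> : \matrix_(i, j) cis (D Phi i j + DL t i j) =
    \matrix_(i, j) cis (Phi i j + L t i j
      + (- (Phi i o + L t i o) + (Phi o o + L t o o)) + - (Phi o j + L t o j)).
    by apply/matrixP => i j; rewrite !mxE; congr cis; ring.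
  exact: complex_hadamard_dephase (fun i j => Phi i j + L t i j) _ _ (hL t).
Qed.

(** * Choice of the pairing and of the N/2 + 1 parameters *)

Theorem theorem3p5 (R : realType) (N : nat) (H : 'M[R]_N)
    (hN : (12 <= N)%N) (hH : real_hadamard H) :
  admits_affine_orbit (N./2 + 1)%N (map_mx (real_complex R) H).
Proof.
have N0 : (0 < N)%N by apply: leq_trans hN.
have N1 : (1 < N)%N by apply: leq_trans hN.
pose c := Ordinal N0; pose d := Ordinal N1.
have cd : c != d by [].
pose f : pred 'I_N := [pred i | H i c == H i d].
have cf : (#|f|.*2 = N)%N := card_col_agree hH cd.
have N4 := real_hadamard_dvdn4 hH (leq_trans (isT : 2 < 12)%N hN).
pose bad a b k l := exists e, forall j, H a j * H b j = e * (H k j * H l j).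
(* If the product of rows a and b were proportional to that of k, l and to that of k, l', cancelling
   row k would make rows l and l' proportional. *)
have sepbad a b k l l' : l != l' -> bad a b k l -> ~ bad a b k l'.
  move=> ll' [e he] [e' he'];
  apply: (real_hadamard_row_free hH (a := e' / e) ll') => j.
  have e0 : e != 0.
    apply/eqP => e0; have := he j; rewrite e0 mul0r => /eqP.
    by case: (real_hadamard_signM hH a j b j) => ->; rewrite ?oppr_eq0 oner_eq0.
  have := he' j; rewrite he => h.
  have hk := real_hadamard_sqr hH k j.
  have -> : H l j = e^-1 * (H k j * (e * (H k j * H l j))).
    by rewrite [H k j * _]mulrCA mulKf // mulrA hk mul1r.
  by rewrite h [H k j * _]mulrCA [H k j * (_ * _)]mulrA hk mul1r; ring.
have cN : #|'I_N| = (N./2).*2 by rewrite card_ord -cf doubleK.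
have ef : ~~ odd #|f|.
  case/dvdnP: N4 => k N4; have -> : (#|f| = k.*2)%N by lia.
  by rewrite odd_double.
have f4 : (4 < #|f|)%N by lia.
have [s [g [[sK s_neq gs g_onto fs] [p [q [fp fq npq]]]]]] :=
  exists_pairing cN ef f4 sepbad.
(* The first N/2 coordinates are the angles of the row pairs, indexed by [g]; the last one is the
   angle of the column rotation. *)
pose x (t : 'rV[R]_(N./2 + 1)) i := t 0 (lshift 1 (g i)).
pose y (t : 'rV[R]_(N./2 + 1)) j := t 0 (rshift N./2 0) *+ ((j == c) || (j == d)).
pose th t : 'M[R]_N := \matrix_(i, j) (x t i * (H i j * H (s i) j)
  + y t j * (H i j * H i (tperm c d j))).
have th_linear : linear th.
  by move=> a u v; apply/matrixP => i j; rewrite !mxE /x /y !mxE mulrnDl -mulrnAr; ring.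
pose L : {linear 'rV[R]_(N./2 + 1) -> 'M[R]_N} :=
  HB.pack th (GRing.isLinear.Build _ _ _ _ th th_linear).
pose Phi : 'M[R]_N := \matrix_(i, j) (if H i j == 1 then 0 else pi).
have cisPhi i j : cis (Phi i j) = (H i j)%:C.
  rewrite mxE; case: (hH.1 i j) => ->; rewrite ?eqxx ?cis0 //.
  rewrite ifF; last by apply/eqP; lra.
  by rewrite /cis cospi sinpi.
have -> : map_mx (real_complex R) H = \matrix_(i, j) cis (Phi i j).
  by apply/matrixP => i j; rewrite [RHS]mxE cisPhi mxE.
(* Column c has index 0, so it also serves as the origin for dephasing. *)
apply: (@affine_orbit_dephase _ _ _ c Phi L) => // t.
  have -> : \matrix_(i, j) cis (Phi i j + L t i j) = \matrix_(i, j) ((H i j)%:C *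
      cis (x t i * (H i j * H (s i) j) + y t j * (H i j * H i (tperm c d j)))).
    by apply/matrixP => i j; rewrite [LHS]mxE [RHS]mxE cisD cisPhi [L t i j]mxE.
  apply: rotated_complex_hadamard => //.
  - by move=> i; rewrite /x gs.
  - exact: tpermK.
  - move=> j; rewrite /y; case: tpermP => [->|->|//]; rewrite !eqxx ?orbT //.
  - move=> i j; rewrite /y; have pm : (1 == -1 :> R) = false by apply/eqP; lra.
    have mp : (-1 == 1 :> R) = false by apply/eqP; lra.
    (* Rows i and s i both agree or both disagree on columns c and d, so the two row products have
       the same sign there. This is the compatibility between the two rotations. *)
    have e : H i c * H (s i) c = H i d * H (s i) d.
      have := fs i; rewrite /f /=.
      by case: (hH.1 i c) => ->; case: (hH.1 i d) => ->; case: (hH.1 (s i) c) => ->;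
        case: (hH.1 (s i) d) => ->; rewrite ?eqxx ?pm ?mp ?mulr1 ?mul1r ?mulrNN ?mulr1.
    case: (eqVneq j c) => [->|jc]; first by right; rewrite tpermL.
    by case: (eqVneq j d) => [->|jd]; [right; rewrite tpermR | left].
move=> sep.
have [||||y0 x0] := @phases_independent _ _ _ hH c d s (x t) (t 0 (rshift N./2 0)) p q
  (fun i j => th t i j) _ cd s_neq _ _ _ npq sep.
- exact: leq_trans hN.
- move=> i j; rewrite mxE /y; case: (eqVneq j c) => [->|jc]; first by rewrite tpermL.
  case: (eqVneq j d) => [->|jd]; last by rewrite mulr0n !mul0r.
  by rewrite tpermR [H i d * H i c]mulrC.
- exact/eqP.
- exact/eqP.
apply/rowP => k; rewrite mxE; case: (split_ordP k) => l ->.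
  by have [i <-] := g_onto l; apply: x0.
by rewrite (ord1 l).
Qed.
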